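(* (Introduction.) Let $t$ be a closed irreducible proof-term of $A$ (i.e. $\varnothing;\varnothing\vdash t:A$ and $t$ has no one-step reduct). - If $A$ is $\mathfrak 1$, then $t$ has the form $a.\star$. - If $A$ has the form $B\multimap C$, then $t$ has the form $\lambda x^B.u$. - If $A$ has the form $B\otimes C$, then $t$ has the form $u\otimes v$, $u\boxplus v$, or $a\bullet u$. - If $A$ is $\top$, then $t$ is $\langle\rangle$. - The proposition $A$ is not $\mathfrak 0$. - If $A$ has the form $B\mathbin{\&}C$, then $t$ has the form $\langle u,v\rangle$. - If $A$ has the form $B\oplus C$, then $t$ has the form $\mathit{inl}(u)$, $\mathit{inr}(u)$, $u\boxplus v$, or $a\bullet u$. - If $A$ has the form ${!}B$, then $t$ has the form ${!}u$, $u\boxplus v$, or $a\bullet u$.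
   Context: The $\mathcal L_!^{\mathcal S}$-calculus. Let $\mathcal S$ be a commutative semiring, whose elements are called scalars. Propositions are generated by $A ::= \mathfrak 1\mid A\multimap A\mid A\otimes A\mid\top\mid\mathfrak 0\mid A\mathbin{\&}A\mid A\oplus A\mid {!}A$. Proof-terms, taken modulo $\alpha$-equivalence, are generated by (with $a\in\mathcal S$) $t ::= x\mid t\boxplus u\mid a\bullet t\mid a.\star\mid\delta_{\mathfrak 1}(t,u)\mid\lambda x^A.t\mid t\,u\mid t\otimes u\mid\delta_\otimes(t,x^Ay^B.u)\mid\langle\rangle\mid\delta_{\mathfrak 0}(t)\mid\langle t,u\rangle\mid\delta_{\&}^1(t,x^A.u)\mid\delta_{\&}^2(t,x^B.u)\mid\mathit{inl}(t)\mid\mathit{inr}(t)\mid\delta_\oplus(t,x^A.u,y^B.v)\mid {!}t\mid\delta_!(t,x^A.u)$. Variables before a dot are bound in the term after it; $(u/x)t$ is capture-avoiding substitution of $u$ for $x$ in $t$. Judgements $\Upsilon;\Gamma\vdash t:A$ have an intuitionistic context $\Upsilon$ and a linear context $\Gamma$ (finite sets of typed variables; $\Gamma,\Delta$ is disjoint union). Typing rules: - $\Upsilon;x^A\vdash x:A$; and $\Upsilon,x^A;\varnothing\vdash x:A$. - If $\Upsilon;\Gamma\vdash t:A$ and $\Upsilon;\Gamma\vdash u:A$ then $\Upsilon;\Gamma\vdash t\boxplus u:A$. If $\Upsilon;\Gamma\vdash t:A$ then $\Upsilon;\Gamma\vdash a\bullet t:A$. - $\Upsilon;\varnothing\vdash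 a.\star:\mathfrak 1$. If $\Upsilon;\Gamma\vdash t:\mathfrak 1$ and $\Upsilon;\Delta\vdash u:A$ then $\Upsilon;\Gamma,\Delta\vdash\delta_{\mathfrak 1}(t,u):A$. - If $\Upsilon;\Gamma,x^A\vdash t:B$ then $\Upsilon;\Gamma\vdash\lambda x^A.t:A\multimap B$. If $\Upsilon;\Gamma\vdash t:A\multimap B$ and $\Upsilon;\Delta\vdash u:A$ then $\Upsilon;\Gamma,\Delta\vdash t\,u:B$. - If $\Upsilon;\Gamma\vdash t:A$ and $\Upsilon;\Delta\vdash u:B$ then $\Upsilon;\Gamma,\Delta\vdash t\otimes u:A\otimes B$. If $\Upsilon;\Gamma\vdash t:A\otimes B$ and $\Upsilon;\Delta,x^A,y^B\vdash u:C$ then $\Upsilon;\Gamma,\Delta\vdash\delta_\otimes(t,x^Ay^B.u):C$. - $\Upsilon;\Gamma\vdash\langle\rangle:\top$. If $\Upsilon;\Gamma\vdash t:\mathfrak 0$ then $\Upsilon;\Gamma,\Delta\vdash\delta_{\mathfrak 0}(t):C$. - If $\Upsilon;\Gamma\vdash t:A$ and $\Upsilon;\Gamma\vdash u:B$ then $\Upsilon;\Gamma\vdash\langle t,u\rangle:A\mathbin{\&}B$. If $\Upsilon;\Gamma\vdash t:A\mathbin{\&}B$ and $\Upsilon;\Delta,x^A\vdash u:C$ (resp. $\Upsilon;\Delta,x^B\vdash u:C$) then $\Upsilon;\Gamma,\Delta\vdash\delta_{\&}^1(t,x^A.u):C$ (resp. $\delta_{\&}^2(t,x^B.u):C$). -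 If $\Upsilon;\Gamma\vdash t:A$ (resp. $t:B$) then $\Upsilon;\Gamma\vdash\mathit{inl}(t):A\oplus B$ (resp. $\mathit{inr}(t):A\oplus B$). If $\Upsilon;\Gamma\vdash t:A\oplus B$, $\Upsilon;\Delta,x^A\vdash u:C$ and $\Upsilon;\Delta,y^B\vdash v:C$ then $\Upsilon;\Gamma,\Delta\vdash\delta_\oplus(t,x^A.u,y^B.v):C$. - If $\Upsilon;\varnothing\vdash t:A$ then $\Upsilon;\varnothing\vdash {!}t:{!}A$. If $\Upsilon;\Gamma\vdash t:{!}A$ and $\Upsilon,x^A;\Delta\vdash u:B$ then $\Upsilon;\Gamma,\Delta\vdash\delta_!(t,x^A.u):B$. Reduction $\longrightarrow$ is the closure under arbitrary term contexts of: $\delta_{\mathfrak 1}(a.\star,t)\to a\bullet t$; $(\lambda x^A.t)\,u\to(u/x)t$; $\delta_\otimes(u\otimes v,x^Ay^B.w)\to(u/x,v/y)w$; $\delta_{\&}^i(\langle t_1,t_2\rangle,x^A.v)\to(t_i/x)v$ ($i=1,2$); $\delta_\oplus(\mathit{inl}(t),x^A.v,y^B.w)\to(t/x)v$; $\delta_\oplus(\mathit{inr}(u),x^A.v,y^B.w)\to(u/y)w$; $\delta_!({!}t,x^A.u)\to(t/x)u$; $a.\star\boxplus b.\star\to(a+b).\star$; $(\lambda x^A.t)\boxplus(\lambda x^A.u)\to\lambda x^A.(t\boxplus u)$; $\delta_\otimes(t\boxplus u,x^Ay^B.v)\to\delta_\otimes(t,x^Ay^B.v)\boxplus\delta_\otimes(u,x^Ay^B.v)$;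 $\langle\rangle\boxplus\langle\rangle\to\langle\rangle$; $\langle t,u\rangle\boxplus\langle v,w\rangle\to\langle t\boxplus v,u\boxplus w\rangle$; $\delta_\oplus(t\boxplus u,x^A.v,y^B.w)\to\delta_\oplus(t,x^A.v,y^B.w)\boxplus\delta_\oplus(u,x^A.v,y^B.w)$; $\delta_!(t\boxplus u,x^A.v)\to\delta_!(t,x^A.v)\boxplus\delta_!(u,x^A.v)$; $a\bullet b.\star\to(a\times b).\star$; $a\bullet\lambda x^A.t\to\lambda x^A.a\bullet t$; $\delta_\otimes(a\bullet t,x^Ay^B.v)\to a\bullet\delta_\otimes(t,x^Ay^B.v)$; $a\bullet\langle\rangle\to\langle\rangle$; $a\bullet\langle t,u\rangle\to\langle a\bullet t,a\bullet u\rangle$; $\delta_\oplus(a\bullet t,x^A.v,y^B.w)\to a\bullet\delta_\oplus(t,x^A.v,y^B.w)$; $\delta_!(a\bullet t,x^A.v)\to a\bullet\delta_!(t,x^A.v)$. *)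

(* Defs.v *)
From mathcomp Require Import all_boot all_algebra.
From mathcomp Require Import finmap.

Set Implicit Arguments.
Unset Strict Implicit.
Unset Printing Implicit Defensive.

Local Open Scope fset_scope.
Local Open Scope fmap_scope.

Inductive ty : Type :=
| One
| Lolli of ty & ty
| Tensor of ty & ty
| Top
| Zero
| With of ty & ty
| Plus of ty & ty
| Bang of ty.

(* Proof-terms modulo alpha-equivalence, as de Bruijn terms.  A binder x^A
   becomes the annotation A, and the bound variable is index 0 in the term in
   its scope.  In DTens t A B u, which stands for delta_tensor(t, x^A y^B.u),
   y is index 0 of u and x is index 1. *)
Inductive term (S : comPzSemiRingType) : Type :=
| Var of nat
| Sum of term S & term S      (* the boxed plus *)
| Scal of S & term S          (* a bullet t *)
| Star of S                   (* the scalar-indexed star, a.star *)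
| DOne of term S & term S
| Lam of ty & term S
| App of term S & term S
| Tens of term S & term S
| DTens of term S & ty & ty & term S
| Unit                        (* the empty pair, of type Top *)
| DZero of term S
| Pair of term S & term S
| DWith1 of term S & ty & term S
| DWith2 of term S & ty & term S
| Inl of term S
| Inr of term S
| DPlus of term S & ty & term S & ty & term S
| Prom of term S              (* !t *)
| DBang of term S & ty & term S.

Arguments Var {S} _.
Arguments Unit {S}.

Section Substitution.
Variable S : comPzSemiRingType.
Implicit Types t u v w : term S.

Definition up_ren (r : nat -> nat) : nat -> nat :=
  fun n => if n is n'.+1 then (r n').+1 else 0%N.

Fixpoint rename (r : nat -> nat) (t : term S) : term S :=
  match t with
  | Var n => Var (r n)
  | Sum t u => Sum (rename r t) (rename r u)
  | Scal a t => Scal a (rename r t)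
  | Star a => Star a
  | DOne t u => DOne (rename r t) (rename r u)
  | Lam A t => Lam A (rename (up_ren r) t)
  | App t u => App (rename r t) (rename r u)
  | Tens t u => Tens (rename r t) (rename r u)
  | DTens t A B u => DTens (rename r t) A B (rename (up_ren (up_ren r)) u)
  | Unit => Unit
  | DZero t => DZero (rename r t)
  | Pair t u => Pair (rename r t) (rename r u)
  | DWith1 t A u => DWith1 (rename r t) A (rename (up_ren r) u)
  | DWith2 t B u => DWith2 (rename r t) B (rename (up_ren r) u)
  | Inl t => Inl (rename r t)
  | Inr t => Inr (rename r t)
  | DPlus t A u B v =>
      DPlus (rename r t) A (rename (up_ren r) u) B (rename (up_ren r) v)
  | Prom t => Prom (rename r t)
  | DBang t A u => DBang (rename r t) A (rename (up_ren r) u)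
  end.

Definition scons (u : term S) (s : nat -> term S) : nat -> term S :=
  fun n => if n is n'.+1 then s n' else u.

Definition up (s : nat -> term S) : nat -> term S :=
  scons (Var 0) (fun n => rename succn (s n)).

Fixpoint subst (s : nat -> term S) (t : term S) : term S :=
  match t with
  | Var n => s n
  | Sum t u => Sum (subst s t) (subst s u)
  | Scal a t => Scal a (subst s t)
  | Star a => Star a
  | DOne t u => DOne (subst s t) (subst s u)
  | Lam A t => Lam A (subst (up s) t)
  | App t u => App (subst s t) (subst s u)
  | Tens t u => Tens (subst s t) (subst s u)
  | DTens t A B u => DTens (subst s t) A B (subst (up (up s)) u)
  | Unit => Unit
  | DZero t => DZero (subst s t)
  | Pair t u => Pair (subst s t) (subst s u)
  | DWith1 t A u => DWith1 (subst s t) A (subst (up s) u)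
  | DWith2 t B u => DWith2 (subst s t) B (subst (up s) u)
  | Inl t => Inl (subst s t)
  | Inr t => Inr (subst s t)
  | DPlus t A u B v => DPlus (subst s t) A (subst (up s) u) B (subst (up s) v)
  | Prom t => Prom (subst s t)
  | DBang t A u => DBang (subst s t) A (subst (up s) u)
  end.

(* subst1 u t is (u/x)t, with x index 0 of t. *)
Definition subst1 (u t : term S) : term S := subst (scons u Var) t.

(* subst2 u v w is (u/x, v/y)w, with x index 1 and y index 0 of w; u and v
   live outside both binders. *)
Definition subst2 (u v w : term S) : term S :=
  subst (scons v (scons u Var)) w.

End Substitution.

(* A context is a finite set of variables (free de Bruijn indices) with their
   types. *)
Notation ctx := {fmap nat -> ty}.

(* The context G seen from under one more binder: index n becomes n + 1, and
   index 0 is not declared. *)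
Definition shift (G : ctx) : ctx :=
  reducef [fmap x : [fset n.+1 | n in domf G] => G.[? (val x).-1]].

(* G, x^A where x is the variable of a binder just entered. *)
Definition bind (G : ctx) (A : ty) : ctx := (shift G).[0%N <- A].

Lemma fnd_shift (G : ctx) n :
  (shift G).[? n] = if n is n'.+1 then G.[? n'] else None.
Proof.
rewrite /shift fnd_reducef; case: n => [|n].
  by rewrite not_fnd //; apply/negP => /imfsetP [].
case: (boolP (n \in domf G)) => nG.
  have h : n.+1 \in [fset k.+1 | k in domf G] by apply/imfsetP; exists n.
  by rewrite in_fnd ffunE.
rewrite not_fnd ?not_fnd //.
by apply/negP => /imfsetP [m /= mG [nm]]; rewrite nm mG in nG.
Qed.

Lemma fnd_bind (G : ctx) A n :
  (bind G A).[? n] = if n is n'.+1 then G.[? n'] else Some A.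
Proof. by rewrite /bind fnd_set; case: n => [|n] //=; rewrite fnd_shift. Qed.

Section Judgements.
Variable S : comPzSemiRingType.
Implicit Types (Y G D : ctx) (t u v w : term S).

(* has_type Y G t A is Y; G |- t : A.  The two zones are meant to be disjoint:
   if they are so in the conclusion of a rule, they are so in its premises,
   hence in a whole derivation that ends with disjoint zones. *)
Inductive has_type : ctx -> ctx -> term S -> ty -> Prop :=
| T_lin Y x A :
    has_type Y [fmap].[x <- A] (Var x) A
| T_int Y x A :
    Y.[? x] = Some A -> has_type Y [fmap] (Var x) A
| T_sum Y G t u A :
    has_type Y G t A -> has_type Y G u A -> has_type Y G (Sum t u) A
| T_scal Y G a t A :
    has_type Y G t A -> has_type Y G (Scal a t) A
| T_star Y a :
    has_type Y [fmap] (Star a) One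
| T_done Y G D t u A :
    fdisjoint (domf G) (domf D) ->
    has_type Y G t One -> has_type Y D u A ->
    has_type Y (G + D) (DOne t u) A
| T_lam Y G t A B :
    has_type (shift Y) (bind G A) t B -> has_type Y G (Lam A t) (Lolli A B)
| T_app Y G D t u A B :
    fdisjoint (domf G) (domf D) ->
    has_type Y G t (Lolli A B) -> has_type Y D u A ->
    has_type Y (G + D) (App t u) B
| T_tens Y G D t u A B :
    fdisjoint (domf G) (domf D) ->
    has_type Y G t A -> has_type Y D u B ->
    has_type Y (G + D) (Tens t u) (Tensor A B)
| T_dtens Y G D t u A B C :
    fdisjoint (domf G) (domf D) ->
    has_type Y G t (Tensor A B) ->
    has_type (shift (shift Y)) (bind (bind D A) B) u C ->
    has_type Y (G + D) (DTens t A B u) C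
| T_unit Y G :
    has_type Y G Unit Top
| T_dzero Y G D t C :
    fdisjoint (domf G) (domf D) ->
    has_type Y G t Zero -> has_type Y (G + D) (DZero t) C
| T_pair Y G t u A B :
    has_type Y G t A -> has_type Y G u B -> has_type Y G (Pair t u) (With A B)
| T_dwith1 Y G D t u A B C :
    fdisjoint (domf G) (domf D) ->
    has_type Y G t (With A B) -> has_type (shift Y) (bind D A) u C ->
    has_type Y (G + D) (DWith1 t A u) C
| T_dwith2 Y G D t u A B C :
    fdisjoint (domf G) (domf D) ->
    has_type Y G t (With A B) -> has_type (shift Y) (bind D B) u C ->
    has_type Y (G + D) (DWith2 t B u) C
| T_inl Y G t A B :
    has_type Y G t A -> has_type Y G (Inl t) (Plus A B)
| T_inr Y G t A B :
    has_type Y G t B -> has_type Y G (Inr t) (Plus A B)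
| T_dplus Y G D t u v A B C :
    fdisjoint (domf G) (domf D) ->
    has_type Y G t (Plus A B) ->
    has_type (shift Y) (bind D A) u C -> has_type (shift Y) (bind D B) v C ->
    has_type Y (G + D) (DPlus t A u B v) C
| T_prom Y t A :
    has_type Y [fmap] t A -> has_type Y [fmap] (Prom t) (Bang A)
| T_dbang Y G D t u A B :
    fdisjoint (domf G) (domf D) ->
    has_type Y G t (Bang A) -> has_type (bind Y A) (shift D) u B ->
    has_type Y (G + D) (DBang t A u) B.

Inductive rule : term S -> term S -> Prop :=
| R_one a t : rule (DOne (Star a) t) (Scal a t)
| R_beta A t u : rule (App (Lam A t) u) (subst1 u t)
| R_tens u v A B w : rule (DTens (Tens u v) A B w) (subst2 u v w)
| R_with1 t1 t2 A v : rule (DWith1 (Pair t1 t2) A v) (subst1 t1 v)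
| R_with2 t1 t2 A v : rule (DWith2 (Pair t1 t2) A v) (subst1 t2 v)
| R_plusl t A v B w : rule (DPlus (Inl t) A v B w) (subst1 t v)
| R_plusr u A v B w : rule (DPlus (Inr u) A v B w) (subst1 u w)
| R_bang t A u : rule (DBang (Prom t) A u) (subst1 t u)
| R_sum_star a b : rule (Sum (Star a) (Star b)) (Star (a + b)%R)
| R_sum_lam A t u : rule (Sum (Lam A t) (Lam A u)) (Lam A (Sum t u))
| R_sum_dtens t u A B v :
    rule (DTens (Sum t u) A B v) (Sum (DTens t A B v) (DTens u A B v))
| R_sum_unit : rule (Sum Unit Unit) Unit
| R_sum_pair t u v w :
    rule (Sum (Pair t u) (Pair v w)) (Pair (Sum t v) (Sum u w))
| R_sum_dplus t u A v B w :
    rule (DPlus (Sum t u) A v B w) (Sum (DPlus t A v B w) (DPlus u A v B w))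
| R_sum_dbang t u A v :
    rule (DBang (Sum t u) A v) (Sum (DBang t A v) (DBang u A v))
| R_scal_star a b : rule (Scal a (Star b)) (Star (a * b)%R)
| R_scal_lam a A t : rule (Scal a (Lam A t)) (Lam A (Scal a t))
| R_scal_dtens a t A B v :
    rule (DTens (Scal a t) A B v) (Scal a (DTens t A B v))
| R_scal_unit a : rule (Scal a Unit) Unit
| R_scal_pair a t u : rule (Scal a (Pair t u)) (Pair (Scal a t) (Scal a u))
| R_scal_dplus a t A v B w :
    rule (DPlus (Scal a t) A v B w) (Scal a (DPlus t A v B w))
| R_scal_dbang a t A v :
    rule (DBang (Scal a t) A v) (Scal a (DBang t A v)).

Inductive red : term S -> term S -> Prop :=
| red_rule t t' : rule t t' -> red t t'
| red_sum1 t t' u : red t t' -> red (Sum t u) (Sum t' u)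
| red_sum2 t u u' : red u u' -> red (Sum t u) (Sum t u')
| red_scal a t t' : red t t' -> red (Scal a t) (Scal a t')
| red_done1 t t' u : red t t' -> red (DOne t u) (DOne t' u)
| red_done2 t u u' : red u u' -> red (DOne t u) (DOne t u')
| red_lam A t t' : red t t' -> red (Lam A t) (Lam A t')
| red_app1 t t' u : red t t' -> red (App t u) (App t' u)
| red_app2 t u u' : red u u' -> red (App t u) (App t u')
| red_tens1 t t' u : red t t' -> red (Tens t u) (Tens t' u)
| red_tens2 t u u' : red u u' -> red (Tens t u) (Tens t u')
| red_dtens1 t t' A B u : red t t' -> red (DTens t A B u) (DTens t' A B u)
| red_dtens2 t A B u u' : red u u' -> red (DTens t A B u) (DTens t A B u')
| red_dzero t t' : red t t' -> red (DZero t) (DZero t')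
| red_pair1 t t' u : red t t' -> red (Pair t u) (Pair t' u)
| red_pair2 t u u' : red u u' -> red (Pair t u) (Pair t u')
| red_dwith1_1 t t' A u : red t t' -> red (DWith1 t A u) (DWith1 t' A u)
| red_dwith1_2 t A u u' : red u u' -> red (DWith1 t A u) (DWith1 t A u')
| red_dwith2_1 t t' A u : red t t' -> red (DWith2 t A u) (DWith2 t' A u)
| red_dwith2_2 t A u u' : red u u' -> red (DWith2 t A u) (DWith2 t A u')
| red_inl t t' : red t t' -> red (Inl t) (Inl t')
| red_inr t t' : red t t' -> red (Inr t) (Inr t')
| red_dplus1 t t' A u B v :
    red t t' -> red (DPlus t A u B v) (DPlus t' A u B v)
| red_dplus2 t A u u' B v :
    red u u' -> red (DPlus t A u B v) (DPlus t A u' B v)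
| red_dplus3 t A u B v v' :
    red v v' -> red (DPlus t A u B v) (DPlus t A u B v')
| red_prom t t' : red t t' -> red (Prom t) (Prom t')
| red_dbang1 t t' A u : red t t' -> red (DBang t A u) (DBang t' A u)
| red_dbang2 t A u u' : red u u' -> red (DBang t A u) (DBang t A u').

Definition irreducible (t : term S) : Prop :=
  ~ exists t' : term S, red t t'.

End Judgements.

(* Main.v *)
(* Induction on the typing derivation.  A sum or scaling of closed irreducible
   terms is a redex exactly when A is One, Lolli, Top or With (it commutes with
   the introduction); for Tensor, Plus and Bang it may be irreducible, but then
   the elimination commutes with it.  Hence an elimination is never closed and
   irreducible: by induction its principal argument is an introduction, a sum or
   a scaling, and makes it a redex, while Zero has no closed irreducible term. *)

Require Import Defs.
From mathcomp Require Import all_boot all_algebra.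
From mathcomp Require Import finmap.

Set Implicit Arguments.
Unset Strict Implicit.
Unset Printing Implicit Defensive.

(** The multiplicative rules split the linear context as [G + D]. When the conclusion is closed,
    this makes the premise on the principal argument closed too, so its induction hypothesis
    applies. *)
Lemma catf_eq0 (K : choiceType) (V : Type) (G D : {fmap K -> V}) :
  (G + D)%fset = [fmap]%fmap -> G = [fmap]%fmap /\ D = [fmap]%fmap.
Proof.
move=> e.
have domGD n : ((n \in domf G) || (n \in domf D)) = false.
  by rewrite -mem_catf e inE.
split; apply/fmapP => n; rewrite fnd_fmap0 not_fnd //;
  by apply/negP => nGD; move: (domGD n); rewrite nGD ?orbT.
Qed.

(** Here [f] is a one-hole context, and its hypothesis is an instance of a congruence rule of [red]:
    a step in the hole would be a step of the whole term. *)
Lemma irreducible_context (S : comPzSemiRingType) (f : term S -> term S) t :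
  (forall t', red t t' -> red (f t) (f t')) ->
  irreducible (f t) -> irreducible t.
Proof. by move=> fP irr [t' r]; apply: irr; exists (f t'); apply: fP. Qed.

Lemma irreducible_rule (S : comPzSemiRingType) (t t' : term S) :
  rule t t' -> ~ irreducible t.
Proof. by move=> r irr; apply: irr; exists t'; apply: red_rule. Qed.

Definition is_lincomb (S : comPzSemiRingType) (t : term S) : Prop :=
  (exists u v : term S, t = Sum u v) \/
  (exists (a : S) (u : term S), t = Scal a u).

(** All clauses of the theorem in one predicate, by cases on [A], so that an induction hypothesis
    unfolds as soon as the head of the proposition is known. [False] at [Zero] encodes that no such
    term exists. *)
Definition canonical (S : comPzSemiRingType) (A : ty) (t : term S) : Prop :=
  match A with
  | One => exists a : S, t = Star a
  | Lolli B _ => exists u : term S, t = Lam B u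
  | Tensor _ _ => (exists u v : term S, t = Tens u v) \/ is_lincomb t
  | Top => t = Unit
  | Zero => False
  | With _ _ => exists u v : term S, t = Pair u v
  | Plus _ _ =>
      (exists u : term S, t = Inl u) \/ (exists u : term S, t = Inr u) \/
      is_lincomb t
  | Bang _ => (exists u : term S, t = Prom u) \/ is_lincomb t
  end.

Lemma canonical_irreducible (S : comPzSemiRingType) (A : ty) (t : term S) :
  has_type [fmap]%fmap [fmap]%fmap t A -> irreducible t -> canonical A t.
Proof.
(* Both zones become variables with equations, so that closedness survives as a hypothesis in each
   case of the induction. *)
move eY: {1}[fmap]%fmap => Y; move eG: [fmap]%fmap => G ht.
elim: {Y G t A} ht eY eG => /=.
(* A linear variable has a singleton context: its lookup at [x] is [Some A], while the empty context
   gives [None]. *)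
- move=> Y x A _ e _.
  by have := fnd_set [fmap]%fmap x A x; rewrite -e eqxx fnd_fmap0.
- by move=> Y x A + eY; rewrite -eY fnd_fmap0.
- move=> Y G t u A _ IHt _ IHu eY eG irr.
  have ct := IHt eY eG (irreducible_context (@red_sum1 _ t ^~ u) irr).
  have cu := IHu eY eG (irreducible_context (@red_sum2 _ t u) irr).
  case: A ct cu {IHt IHu} irr => //=;
    (* This settles [Tensor], [Plus] and [Bang], where a sum is itself an allowed form; [Zero] is
       already gone by contradiction. *)
    try by [move=> *; right; left; exists t, u
           |move=> *; right; right; left; exists t, u].
  + by move=> [a ->] [b ->] /(irreducible_rule (R_sum_star a b)).
  (* Both abstractions carry the annotation [B] dictated by the proposition, as the commutation rule
     demands. *)
  + by move=> B C [a ->] [b ->] /(irreducible_rule (R_sum_lam B a b)).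
  + by move=> -> -> /(irreducible_rule (R_sum_unit S)).
  + by move=> B C [a [b ->]] [c [d ->]] /(irreducible_rule (R_sum_pair a b c d)).
- move=> Y G a t A _ IHt eY eG irr.
  have ct := IHt eY eG (irreducible_context (@red_scal _ a t) irr).
  case: A ct {IHt} irr => //=;
    try by [move=> *; right; right; exists a, t
           |move=> *; right; right; right; exists a, t].
  + by move=> [b ->] /(irreducible_rule (R_scal_star a b)).
  + by move=> B C [b ->] /(irreducible_rule (R_scal_lam a B b)).
  + by move=> -> /(irreducible_rule (R_scal_unit a)).
  + by move=> B C [b [c ->]] /(irreducible_rule (R_scal_pair a b c)).
- by move=> Y a _ _ _; exists a.
- move=> Y G D t u A _ _ IHt _ _ eY /esym/catf_eq0[eG _] irr.
  have [b e] := IHt eY (esym eG)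
    (irreducible_context (@red_done1 _ t ^~ u) irr).
  by move: irr; rewrite e => /(irreducible_rule (R_one b u)).
(* Only the head of the term matters, so nothing is asked of the body, which is open. *)
- by move=> Y G t A B *; exists t.
- move=> Y G D t u A B _ _ IHt _ _ eY /esym/catf_eq0[eG _] irr.
  have [b e] := IHt eY (esym eG)
    (irreducible_context (@red_app1 _ t ^~ u) irr).
  by move: irr; rewrite e => /(irreducible_rule (R_beta A b u)).
- by move=> Y G D t u *; left; exists t, u.
- move=> Y G D t u A B C _ _ IHt _ _ eY /esym/catf_eq0[eG _] irr.
  have := IHt eY (esym eG)
    (irreducible_context (f := fun t => DTens t A B u)
       (fun t' => @red_dtens1 _ t t' A B u) irr).
  (* Each form allowed at [Tensor] fires a rule: the cut for a pair [Tens], a commutation for a sum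
     or a scaling. *)
  case=> [[a [b e]]|[[a [b e]]|[a [b e]]]]; move: irr; rewrite e.
  + by move/(irreducible_rule (R_tens a b A B u)).
  + by move/(irreducible_rule (R_sum_dtens a b A B u)).
  + by move/(irreducible_rule (R_scal_dtens a b A B u)).
- by [].
- move=> Y G D t C _ _ IHt eY /esym/catf_eq0[eG _] irr.
  (* The induction hypothesis is [canonical] at [Zero], that is, [False]. *)
  by have := IHt eY (esym eG) (irreducible_context (@red_dzero _ t) irr).
- by move=> Y G t u *; exists t, u.
- move=> Y G D t u A B C _ _ IHt _ _ eY /esym/catf_eq0[eG _] irr.
  have [a [b e]] := IHt eY (esym eG)
    (irreducible_context (f := fun t => DWith1 t A u)
       (fun t' => @red_dwith1_1 _ t t' A u) irr).
  by move: irr; rewrite e => /(irreducible_rule (R_with1 a b A u)).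
- move=> Y G D t u A B C _ _ IHt _ _ eY /esym/catf_eq0[eG _] irr.
  have [a [b e]] := IHt eY (esym eG)
    (irreducible_context (f := fun t => DWith2 t B u)
       (fun t' => @red_dwith2_1 _ t t' B u) irr).
  by move: irr; rewrite e => /(irreducible_rule (R_with2 a b B u)).
- by move=> Y G t *; left; exists t.
- by move=> Y G t *; right; left; exists t.
- move=> Y G D t u v A B C _ _ IHt _ _ _ _ eY /esym/catf_eq0[eG _] irr.
  have := IHt eY (esym eG)
    (irreducible_context (f := fun t => DPlus t A u B v)
       (fun t' => @red_dplus1 _ t t' A u B v) irr).
  case=> [[a e]|[[a e]|[[a [b e]]|[a [b e]]]]]; move: irr; rewrite e.
  + by move/(irreducible_rule (R_plusl a A u B v)).
  + by move/(irreducible_rule (R_plusr a A u B v)).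
  + by move/(irreducible_rule (R_sum_dplus a b A u B v)).
  + by move/(irreducible_rule (R_scal_dplus a b A u B v)).
- by move=> Y t *; left; exists t.
- move=> Y G D t u A B _ _ IHt _ _ eY /esym/catf_eq0[eG _] irr.
  have := IHt eY (esym eG)
    (irreducible_context (f := fun t => DBang t A u)
       (fun t' => @red_dbang1 _ t t' A u) irr).
  case=> [[a e]|[[a [b e]]|[a [b e]]]]; move: irr; rewrite e.
  + by move/(irreducible_rule (R_bang a A u)).
  + by move/(irreducible_rule (R_sum_dbang a b A u)).
  + by move/(irreducible_rule (R_scal_dbang a b A u)).
Qed.

Theorem theorem2p13 (S : comPzSemiRingType) (A : ty) (t : term S) :
  has_type [fmap]%fmap [fmap]%fmap t A ->
  irreducible t ->
  (A = One -> exists a : S, t = Star a) /\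
  (forall B C : ty, A = Lolli B C -> exists u : term S, t = Lam B u) /\
  (forall B C : ty, A = Tensor B C ->
     (exists u v : term S, t = Tens u v) \/
     (exists u v : term S, t = Sum u v) \/
     (exists (a : S) (u : term S), t = Scal a u)) /\
  (A = Top -> t = Unit) /\
  A <> Zero /\
  (forall B C : ty, A = With B C -> exists u v : term S, t = Pair u v) /\
  (forall B C : ty, A = Plus B C ->
     (exists u : term S, t = Inl u) \/
     (exists u : term S, t = Inr u) \/
     (exists u v : term S, t = Sum u v) \/
     (exists (a : S) (u : term S), t = Scal a u)) /\
  (forall B : ty, A = Bang B ->
     (exists u : term S, t = Prom u) \/
     (exists u v : term S, t = Sum u v) \/
     (exists (a : S) (u : term S), t = Scal a u)).
Proof.
move=> ht /(canonical_irreducible ht) {ht} ct.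
repeat match goal with |- _ /\ _ => split end;
  [ move=> e | move=> B C e | move=> B C e | move=> e | move=> e
  | move=> B C e | move=> B C e | move=> B e ];
  (* Once the head of [A] is known, [canonical] computes to the required clause; at [Zero] it is a
     contradiction. *)
  by rewrite e in ct.
Qed.
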